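(* Let $k\geq 3$ be an odd integer. For any coloring $\Delta\colon\mathbb{N}\to\mathbb{N}$ there is an infinite set $X=\{x_1<x_2<\cdots\}\subseteq\mathbb{N}$ such that the set $X^{**}_{alt}=X^{**}_{alt}(k)=\{\sum^{**}_{j\in J}x_j : J\in\binom{\mathbb{N}}{k}\}$ is colored according to one of the following patterns: (i) $X^{**}_{alt}$ is monochromatic; or (ii) $X^{**}_{alt}$ is rainbow; or (iii) $\Delta(\sum^{**}_{i\in I}x_i)=\Delta(\sum^{**}_{j\in J}x_j)$ if and only if $\max I=\max J$, for all $I,J\in\binom{\mathbb{N}}{k}$. Moreover, none of the patterns can be omitted, i.e., for each pattern there is a coloring $\Delta\colon\mathbb{N}\to\mathbb{N}$ such that no infinite $X\subseteq\mathbb{N}$ satisfies either of the other two patterns.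
   Context: $\mathbb{N}$ denotes the set of positive integers; $\binom{\mathbb{N}}{k}$ is the set of $k$-element subsets of $\mathbb{N}$. The elements of $X$ are indexed increasingly $x_1<x_2<\cdots$, and for odd $k$ and $J=\{j_1<j_2<\cdots<j_k\}$, $\sum^{**}_{j\in J}x_j=x_{j_k}-x_{j_{k-1}}+x_{j_{k-2}}-x_{j_{k-3}}+\cdots+x_{j_3}-x_{j_2}+x_{j_1}$. Monochromatic: all elements receive the same color; rainbow: all elements receive pairwise distinct colors. *)

(* Defs.v *)
From mathcomp Require Import all_boot all_order all_algebra finmap.
Set Implicit Arguments.
Unset Strict Implicit.
Unset Printing Implicit Defensive.

Local Open Scope fset_scope.
Local Open Scope nat_scope.

(* A function from the positive integers to the positive integers; the value
   at 0 is unconstrained and never used. *)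
Definition coloring (Delta : nat -> nat) : Prop :=
  forall n, 0 < n -> 0 < Delta n.

(* An infinite set X = {x_1 < x_2 < ...} of positive integers, given by its
   increasing enumeration with indices shifted by one: [x i] is x_{i+1}. *)
Definition infinite_posset (x : nat -> nat) : Prop :=
  (forall i, 0 < x i) /\ (forall i j, i < j -> x i < x j).

(* altseq [:: a_1; a_2; a_3; ...] = (a_1 - a_2) + (a_3 - a_4) + ...; on a
   nonincreasing sequence no subtraction is truncated (see altseqE). *)
Fixpoint altseq (s : seq nat) : nat :=
  match s with
  | [::] => 0
  | [:: a] => a
  | [:: a, b & t] => (a - b) + altseq t
  end.

(* The indices are listed in decreasing order, so that the term of the largest
   index comes first, with sign +. *)
Definition altsum (x : nat -> nat) (J : {fset nat}) : nat :=
  altseq [seq x j | j <- sort geq J].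

Definition altset (k : nat) (x : nat -> nat) (n : nat) : Prop :=
  exists2 J : {fset nat}, #|` J| = k & n = altsum x J.

Definition monochromatic (Delta : nat -> nat) (A : nat -> Prop) : Prop :=
  forall a b, A a -> A b -> Delta a = Delta b.

Definition rainbow (Delta : nat -> nat) (A : nat -> Prop) : Prop :=
  forall a b, A a -> A b -> a <> b -> Delta a <> Delta b.

Definition fsmax (J : {fset nat}) : nat := \max_(j <- J) j.

Definition max_colored (k : nat) (Delta : nat -> nat) (x : nat -> nat) : Prop :=
  forall I J : {fset nat}, #|` I| = k -> #|` J| = k ->
    (Delta (altsum x I) = Delta (altsum x J) <-> fsmax I = fsmax J).

Lemma altseqE (s : seq nat) : sorted geq s ->
  ((altseq s)%:R = \sum_(i < size s) (-1) ^+ i * (nth 0%N s i)%:R :> int)%R.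
Proof.
move: {2}(size s) (leqnn (size s)) => n.
elim: n s => [|n IH] [|a [|b t]] //= Hs; rewrite ?big_ord0 //.
  by move=> _; rewrite big_ord_recl big_ord0 /= GRing.expr0 GRing.mul1r GRing.addr0.
case/andP=> Hba Hp; rewrite 2!big_ord_recl /= GRing.natrD GRing.natrB //.
rewrite IH; [|exact: ltnW|exact: path_sorted Hp].
rewrite GRing.expr0 GRing.mul1r GRing.expr1 GRing.mulN1r GRing.addrA.
congr (_ + _)%R; apply: eq_bigr => i _.
by rewrite /bump /= !add1n !GRing.exprS !GRing.mulN1r GRing.opprK.
Qed.

Lemma altsumE (x : nat -> nat) (J : {fset nat}) : infinite_posset x ->
  ((altsum x J)%:R = \sum_(i < #|` J|)
     (-1) ^+ i * (x (nth 0%N (sort geq J) i))%:R :> int)%R.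
Proof.
case=> _ x_inc; rewrite /altsum altseqE.
  rewrite size_map size_sort; apply: eq_bigr => i _.
  by rewrite (nth_map 0) // size_sort.
rewrite sorted_map; apply: (@sub_sorted _ geq).
  by move=> i j /=; rewrite leq_eqVlt => /predU1P[->|/x_inc /ltnW].
by apply: sort_sorted => i j; apply: leq_total.
Qed.

(* Main.v *)
Require Import Defs.
From mathcomp Require Import all_boot finmap zify.
From mathcomp Require Import boolp classical_sets filter.

(* The idea is to take for X the partial sums x_j = h + y_0 + ... + y_{j-1}.  An
   alternating sum with an odd number of terms is then h plus a finite sum of
   distinct y_i, and the y_i of largest index is determined by max J.  The y_i
   are chosen generically for an idempotent ultrafilter p on the positive
   integers; (p n) means that what follows holds for p-almost all n.
   If (p a)(p b) c(a+b) = c(a), all sums can be given the color of h.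
   Otherwise, if (p a)(p b)(p n) c(a+b+n) = c(a+n), then the color of a sum
   depends only on its last summand, and each new summand brings a new color.
   In the remaining case all sums get distinct colors: were c(u+b+n) = c(v+n)
   for generic b and n, idempotence would allow replacing b by b+d, whence
   c(u+b+d+n) = c(u+b+n), contrary to assumption. *)

Set Implicit Arguments.
Unset Strict Implicit.
Unset Printing Implicit Defensive.

Local Open Scope classical_set_scope.

(** * Ultrafilters and joins of filters *)

Lemma ultra_notin (T : Type) (p : set_system T) (A : set T) :
  UltraFilter p -> ~ p A -> p (~` A).
Proof. by move=> pU npA; case: (in_ultra_setVsetC A pU). Qed.

Lemma ultra_setC (T : Type) (p : set_system T) (A : set T) :
  UltraFilter p -> p (~` A) -> ~ p A.
Proof.
by move=> pU pnA pA; have [x []] := filter_ex (filterI pA pnA).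
Qed.

Lemma ultra_dichotomy (T : Type) (p : set_system T) :
  ProperFilter p -> (forall A, p A \/ p (~` A)) -> UltraFilter p.
Proof.
move=> pF pd; split=> // G GF pG; apply/seteqP; split=> // A GA.
have [//|/pG GnA] := pd A; by have [x []] := filter_ex (filterI GA GnA).
Qed.

(** In terms of the ultrafilters extending a filter, the join stands for the intersection of two
    closed sets of ultrafilters. *)
Definition filter_join (T : Type) (F G : set_system T) : set_system T :=
  [set A | exists B C, [/\ F B, G C & B `&` C `<=` A]].

Lemma filter_join_proper (T : Type) (F G : set_system T) :
  Filter F -> Filter G -> (forall B C, F B -> G C -> B `&` C !=set0) ->
  ProperFilter (filter_join F G).
Proof.
move=> FF GF FG; split.
  by move=> [B [C [FB GC BC]]]; have [x /BC] := FG _ _ FB GC.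
split.
- by exists setT, setT; split=> //; exact: filterT.
- move=> A A' [B [C [FB GC BC]]] [B' [C' [FB' GC' BC']]].
  exists (B `&` B'), (C `&` C'); split;
    [exact: (@filterI _ F)|exact: (@filterI _ G)|].
  by move=> x [[? ?] [? ?]]; split; [exact: BC|exact: BC'].
- by move=> A A' AA' [B [C [FB GC BC]]]; exists B, C; split=> // x /BC /AA'.
Qed.

Lemma filter_joinl (T : Type) (F G : set_system T) :
  Filter G -> F `<=` filter_join F G.
Proof. by move=> GF A FA; exists A, setT; split=> //; exact: filterT. Qed.

Lemma filter_joinr (T : Type) (F G : set_system T) :
  Filter F -> G `<=` filter_join F G.
Proof. by move=> GF A FA; exists setT, A; split=> //; exact: filterT. Qed.

(** If [A] is not in [F], then [F] has a proper join with the filter of supersets of the complement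
    of [A], and an ultrafilter above this join cannot contain [A]. *)
Lemma filter_ultra_cap (T : Type) (F : set_system T) (A : set T) :
  Filter F -> (forall p, UltraFilter p -> F `<=` p -> p A) -> F A.
Proof.
move=> FF FA; apply: contrapT => nFA.
have nA_filter : Filter [set B | ~` A `<=` B].
  split=> [x _|B C AB nAC x nAx|B C BC AB x nAx] //; last exact/BC/AB.
  by split; [exact: AB|exact: nAC].
have JF : ProperFilter (filter_join F [set B | ~` A `<=` B]).
  apply: filter_join_proper => B C FB nAC; apply: contrapT => BC0; apply: nFA.
  by apply: filterS FB => x Bx; apply: contrapT => /nAC Cx; apply: BC0;
    exists x.
have [p [pU Jp]] := ultraFilterLemma JF.
have pnA : p (~` A) by apply: Jp; exact: filter_joinr.
by apply: (ultra_setC pU pnA); apply: FA => //; apply: subset_trans Jp;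
  exact: filter_joinl.
Qed.

(** * The product of ultrafilters *)

Section uprod.
Context (T : Type) (op : T -> T -> T).

Definition uquot (q : set_system T) (A : set T) : set T :=
  [set m | q [set n | A (op m n)]].

(** The extension of [op] to the Stone-Cech compactification. Set systems are allowed as factors
    because, for a filter [F], [uprod F p] encodes the closed set of all products [uprod q p] with
    [q] an ultrafilter above [F]. *)
Definition uprod (p q : set_system T) : set_system T :=
  [set A | p (uquot q A)].

Lemma uquotS (q : set_system T) (A B : set T) :
  Filter q -> A `<=` B -> uquot q A `<=` uquot q B.
Proof. by move=> qF AB m; apply: filterS => n /AB. Qed.

Lemma uquotI (q : set_system T) (A B : set T) :
  Filter q -> uquot q A `&` uquot q B `<=` uquot q (A `&` B).
Proof. by move=> qF m [mA mB]; exact: filterI. Qed.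

Lemma uprod_proper (p q : set_system T) :
  ProperFilter p -> ProperFilter q -> ProperFilter (uprod p q).
Proof.
move=> pF qF; split; first by move=> pq0; have [m] := @filter_ex _ p _ _ pq0;
  exact: filter_not_empty.
split.
- by apply: (@filterS _ p _ setT) => [m _|]; exact: filterT.
- move=> A B pA pB.
  by apply: (@filterS _ p _ _ _ _ (@filterI _ p _ _ _ pA pB)); exact: uquotI.
- by move=> A B AB; apply: (@filterS _ p); exact: uquotS.
Qed.

Lemma uprod_ultra (p q : set_system T) :
  UltraFilter p -> UltraFilter q -> UltraFilter (uprod p q).
Proof.
move=> pU qU; apply: ultra_dichotomy; first exact: uprod_proper.
move=> A; have [pA|] := pselect (uprod p q A); first by left.
by move=> /(ultra_notin pU) pnA; right;
  apply: (@filterS _ p) pnA => m /(ultra_notin qU).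
Qed.

Lemma uprodA (p q r : set_system T) : associative op ->
  uprod p (uprod q r) = uprod (uprod p q) r.
Proof.
move=> opA; apply/funext => A; rewrite /uprod /uquot /=.
congr (p _); apply/funext => m; congr (q _); apply/funext => n.
by congr (r _); apply/funext => l /=; rewrite opA.
Qed.

(** For ultrafilters [p] and [r], this filter encodes the fibre over [r] of right multiplication by
    [p]: the ultrafilters above it are the solutions [q] of [uprod q p = r]. *)
Definition uquot_filter (p r : set_system T) : set_system T :=
  filter_from r (uquot p).

Lemma uquot_filter_filter (p r : set_system T) :
  Filter p -> Filter r -> Filter (uquot_filter p r).
Proof.
move=> pF rF; apply: filter_from_filter; first by exists setT; exact: filterT.
by move=> A B rA rB; exists (A `&` B); [exact: filterI|move=> m mAB; split;
  apply: filterS mAB => n []].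
Qed.

Lemma uquot_filterP (p q r : set_system T) :
  UltraFilter p -> UltraFilter q -> UltraFilter r ->
  (uquot_filter p r `<=` q) <-> uprod q p = r.
Proof.
move=> pU qU rU; split=> [rq|<- B [A qA AB]];
  last exact: (@filterS _ q _ _ _ AB qA).
apply: max_filter; first exact/ultra_proper/uprod_ultra.
by move=> A rA; apply: rq; exists A.
Qed.

(** Were some [B] in [F] disjoint from [uquot p A] with [A] in [r], then the complement of [A] would
    be in [uprod F p], hence in [r]. *)
Lemma uquot_filter_join_proper (F p r : set_system T) :
  Filter F -> UltraFilter p -> UltraFilter r -> uprod F p `<=` r ->
  ProperFilter (filter_join F (uquot_filter p r)).
Proof.
move=> FF pU rU Fpr; apply: filter_join_proper.
  exact: uquot_filter_filter.
move=> B C FB [A rA nAC]; apply: contrapT => BC0.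
apply: (@ultra_setC _ r A) => //; apply: Fpr; apply: filterS FB => m Bm.
by apply: (ultra_notin pU) => mA; apply: BC0; exists m; split=> //; exact: nAC.
Qed.

(** Compactness: right multiplication by [p] maps the ultrafilters above [F] onto those above
    [uprod F p]. *)
Lemma uprod_lift (F p r : set_system T) :
  Filter F -> UltraFilter p -> UltraFilter r -> uprod F p `<=` r ->
  exists q, [/\ UltraFilter q, F `<=` q & uprod q p = r].
Proof.
move=> FF pU rU /(uquot_filter_join_proper FF pU rU)
  /ultraFilterLemma[q [qU Jq]].
have rF := uquot_filter_filter (p := p) (r := r) _ _.
exists q; split=> //; first by apply: subset_trans Jq; apply: filter_joinl;
  exact: rF.
by apply/uquot_filterP => //; apply: subset_trans Jq; exact: filter_joinr.
Qed.

(** * Existence of idempotent ultrafilters *)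

(* The ultrafilters extending F form a closed subsemigroup of the
   Stone-Cech compactification, and every closed subsemigroup arises so. *)
Definition semigroup_filter (F : set_system T) : Prop :=
  ProperFilter F /\
  forall p q, UltraFilter p -> UltraFilter q -> F `<=` p -> F `<=` q ->
    F `<=` uprod p q.

Lemma maximal_semigroup_filter (S : set T) :
  S !=set0 -> (forall a b, S a -> S b -> S (op a b)) ->
  exists F, [/\ semigroup_filter F, F S &
    forall G, semigroup_filter G -> F `<=` G -> G = F].
Proof.
move=> [s Ss] Sop.
pose P (F : set_system T) := F = set0 \/ (semigroup_filter F /\ F S).
have PS : P [set A | S `<=` A].
  right; split=> //; split.
    split; first by move=> /(_ s Ss).
    split=> // [A B SA SB x Sx|A B AB SA x Sx]; last exact/AB/SA.
    by split; [exact: SA|exact: SB].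
  move=> p q pU qU Sp Sq A SA; apply: filterS (Sp S _) => // m Sm.
  by apply: filterS (Sq S _) => // n Sn; exact/SA/Sop.
have [|F [PF Fmax]] := @Zorn_bigcup (set T) P.
  move=> C CP Ctot.
  have [[F0 CF0 [A0 FA0]]|C0] := pselect (exists2 F, C F & F !=set0);
    last first.
    left; rewrite -subset0 => A [F CF FA]; apply: C0; exists F => //;
      by exists A.
  have CF F A : C F -> F A -> semigroup_filter F /\ F S.
    by move=> /CP [->|].
  have [[F0P _] F0S] := CF _ _ CF0 FA0.
  right; split; last by exists F0.
  split.
    split; first by move=> [F /CF + F0']; move=> /(_ _ F0')[[FP _] _];
      exact: filter_not_empty F0'.
    split.
    - by exists F0 => //; exact: filterT.
    - move=> A B [F FC FA] [G GC GB]; have [[FP _] _] := CF _ _ FC FA.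
      have [[GP _] _] := CF _ _ GC GB.
      by have [FG|GF] := Ctot _ _ FC GC; [exists G|exists F] => //;
        apply: filterI => //; [exact: FG|exact: GF].
    - move=> A B AB [F FC FA]; have [[FP _] _] := CF _ _ FC FA.
      by exists F => //; exact: filterS FA.
  move=> p q pU qU Cp Cq A [F FC FA]; have [[_ Fpq] _] := CF _ _ FC FA.
  by apply: (Fpq p q) => // B FB; [apply: Cp|apply: Cq]; exists F.
have [F0|[FS SF]] := PF.
  have [] := Fmax [set A | S `<=` A] => //; split; first by rewrite F0;
    exact: sub0set.
  by move=> /(_ setT); rewrite F0 => /(_ (fun _ _ => Logic.I)).
exists F; split=> // G GS FG; apply: contrapT => GF; apply: (Fmax G).
  by split=> // GF'; apply: GF; apply/seteqP.
by right; split=> //; exact: FG.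
Qed.

(** The Ellis-Numakura argument: every element [p] of a minimal closed subsemigroup L is idempotent,
    because minimality is applied first to Lp and then to the set of [q] in L with qp = p. *)
Lemma idempotent_ultrafilter (S : set T) : associative op ->
  S !=set0 -> (forall a b, S a -> S b -> S (op a b)) ->
  exists p, [/\ UltraFilter p, p S & uprod p p = p].
Proof.
move=> opA S0 Sop.
have [F [[FP Fop] FS Fmax]] := maximal_semigroup_filter S0 Sop.
have [p [pU Fp]] := ultraFilterLemma FP.
(* Lp is a subsemigroup since (qp)(q'p) = ((qp)q')p, so Lp = L. *)
have F1 : uprod F p = F.
  apply: Fmax; last first.
    by move=> A FA; apply: (@filter_ultra_cap _ F) => q qU Fq; exact: (Fop q p).
  split; first exact: uprod_proper.
  move=> r r' rU r'U /(uprod_lift _ pU rU)[q [qU Fq <-]]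
    /(uprod_lift _ pU r'U)[q' [q'U Fq' <-]].
  rewrite uprodA // => A FpA; apply: (Fop (uprod q p) q' _ _ _ Fq' _ FpA) => //.
    exact: uprod_ultra.
  exact: Fop.
have F1p : uprod F p `<=` p by rewrite F1.
(* [F2] encodes the [q] in L with qp = p. Some such [q] exists because [p] lies in Lp, and they form
   a subsemigroup, hence all of L. *)
pose F2 := filter_join F (uquot_filter p p).
have pF2 : Filter (uquot_filter p p) by exact: uquot_filter_filter.
have FF2 : F `<=` F2 by exact: filter_joinl.
have F2E : F2 = F.
  apply: Fmax => //; split; first exact: uquot_filter_join_proper.
  have F2p q : UltraFilter q -> F2 `<=` q -> F `<=` q /\ uprod q p = p.
    move=> qU F2q; split; first exact: subset_trans F2q.
    by apply/uquot_filterP => //; apply: subset_trans F2q; exact: filter_joinr.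
  move=> q q' qU q'U /(F2p _ qU)[Fq qp]
    /(F2p _ q'U)[Fq' q'p] A [B [C [FB pC BC]]].
  have qq'U := uprod_ultra qU q'U.
  apply: filterS BC _; apply: filterI; first exact: (Fop q q').
  have /uquot_filterP : uprod (uprod q q') p = p by rewrite -uprodA // q'p.
  exact.
exists p; split=> //; first exact: Fp.
by apply/uquot_filterP => //; apply: subset_trans Fp; rewrite -F2E;
  exact: filter_joinr.
Qed.

End uprod.

Lemma filter_seq (T : eqType) (U : Type) (F : set_system U) (s : seq T)
    (A : T -> set U) : Filter F ->
  (forall u, u \in s -> F (A u)) -> F [set n | forall u, u \in s -> A u n].
Proof.
move=> FF; elim: s => [|a s IHs] FA; first by apply: filterS filterT.
have FAs : F [set n | forall u, u \in s -> A u n].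
  by apply: IHs => u us; apply: FA; rewrite inE us orbT.
have FAa : F (A a) by apply: FA; rewrite mem_head.
apply: filterS (filterI FAa FAs) => n [Aan Asn] u.
by rewrite inE => /predU1P[->|/Asn].
Qed.

(** * Alternating sums of partial sums *)

Definition translate_union (D : seq nat) (y : nat) : seq nat :=
  D ++ [seq u + y | u <- D].

Lemma mem_translate_union (D : seq nat) (y v : nat) :
  v \in translate_union D y -> v \in D \/ exists2 u, u \in D & v = u + y.
Proof.
by rewrite mem_cat => /orP[|/mapP[u uD ->]]; [left|right; exists u].
Qed.

(** All sums of [h] and a subset of the first [n] terms of [y]. The doubling recursion reduces the
    choice of the next term to conditions on a finite list. *)
Fixpoint based_sums (h : nat) (y : nat -> nat) (n : nat) : seq nat :=
  if n is m.+1 then translate_union (based_sums h y m) (y m) else [:: h].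

Definition partial_sum (h : nat) (y : nat -> nat) (n : nat) : nat :=
  h + \sum_(i < n) y i.

Lemma partial_sumS h y n : partial_sum h y n.+1 = partial_sum h y n + y n.
Proof. by rewrite /partial_sum big_ord_recr /= addnA. Qed.

Lemma partial_sum_le h y m n : m <= n -> partial_sum h y m <= partial_sum h y n.
Proof.
move=> /subnKC <-; elim: (n - m) => [|d IHd]; rewrite ?addn0 // addnS.
by rewrite partial_sumS (leq_trans IHd) // leq_addr.
Qed.

Lemma infinite_partial_sum h y : 0 < h -> (forall n, 0 < y n) ->
  infinite_posset (partial_sum h y).
Proof.
move=> h0 y0; split=> [i|i j]; first by rewrite addn_gt0 h0.
elim: j => // j IHj; rewrite ltnS leq_eqVlt partial_sumS => /predU1P[->|/IHj].
  by rewrite -addn1 leq_add2l.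
by move=> /leq_trans; apply; exact: leq_addr.
Qed.

Lemma based_sums_le h y m n u : m <= n ->
  u \in based_sums h y m -> u \in based_sums h y n.
Proof.
move=> /subnKC <-; elim: (n - m) => [|d IHd]; rewrite ?addn0 // addnS.
by move=> /IHd uD /=; rewrite mem_cat uD.
Qed.

Lemma partial_sum_based h y n : partial_sum h y n \in based_sums h y n.
Proof.
elim: n => [|n IHn]; first by rewrite /partial_sum big_ord0 addn0 mem_head.
rewrite partial_sumS mem_cat; apply/orP; right; apply/mapP.
by exists (partial_sum h y n).
Qed.

(** The difference is the block of terms of [y] with indices from [b] to [a - 1], none of which is a
    summand of [u]. *)
Lemma based_sums_diff h y a b u : b <= a -> u \in based_sums h y b ->
  partial_sum h y a - partial_sum h y b + u \in based_sums h y a.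
Proof.
move=> /subnKC <- ub; elim: (a - b) => [|d IHd]; first by rewrite addn0 subnn.
rewrite addnS partial_sumS mem_cat; apply/orP; right; apply/mapP.
exists (partial_sum h y (b + d) - partial_sum h y b + u) => //.
by have := @partial_sum_le h y b (b + d) (leq_addr _ _); lia.
Qed.

(** Paired terms give disjoint blocks of consecutive terms of [y]; the unpaired last term gives [h]
    and an initial block. *)
Lemma altseq_based_sums h y s : sorted gtn s -> odd (size s) ->
  altseq (map (partial_sum h y) s) \in based_sums h y (head 0 s).
Proof.
have [n] := ubnP (size s); elim: n s => // n IHn [|a [|b [|c t]]] //.
  by move=> *; exact: partial_sum_based.
rewrite /= !ltnS !negbK => st /andP[ab /andP[bc ct]] ot.
apply: based_sums_diff; first exact: ltnW.
apply: (based_sums_le (ltnW bc)).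
by apply: (IHn (c :: t)) => //=; rewrite ltnW.
Qed.

Lemma sorted_sort_fset (J : {fset nat}) : sorted gtn (sort geq J).
Proof.
rewrite gtn_sorted_uniq_geq sort_uniq fset_uniq.
by apply: sort_sorted => i j; exact: leq_total.
Qed.

Lemma fsmax_head (J : {fset nat}) : fsmax J = head 0 (sort geq J).
Proof.
have := sorted_sort_fset J; rewrite /fsmax.
rewrite (perm_big (sort geq J)) /=; last by rewrite perm_sym perm_sort.
case: (sort geq J) => [|a t]; rewrite ?big_nil // big_cons /=.
rewrite path_sortedE; last by move=> i j l /= ij jl; exact: ltn_trans jl ij.
move=> /andP[/allP at_ _]; apply/maxn_idPl/bigmax_leqP_seq => i it _.
exact/ltnW/at_.
Qed.

Lemma altsum_based_sums h y k (J : {fset nat}) : 3 <= k -> odd k ->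
  #|` J| = k ->
  exists n u, [/\ fsmax J = n.+1, u \in based_sums h y n &
    altsum (partial_sum h y) J = u + y n].
Proof.
move=> k3 ko Jk; rewrite fsmax_head /altsum.
have := sorted_sort_fset J.
have : size (sort geq J) = k by rewrite size_sort.
(* With at least three indices the largest one is positive, so it is a successor [n.+1] and the top
   block ends in [y n]. *)
case: (sort geq J) => [|[|n] [|b [|c t]]] /= st; try by move: k3; rewrite -st.
move=> /and3P[bn cb ct]; exists n.
have := @altseq_based_sums h y (c :: t) ct; set v := altseq _ => vD.
have {}vD : v \in based_sums h y b.
  by apply: based_sums_le (ltnW cb) (vD _); move: ko; rewrite -st /= !negbK.
exists (partial_sum h y n - partial_sum h y b + v); split=> //.
  exact: based_sums_diff.
rewrite -[X in _ + X = _]/v partial_sumS.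
by have := @partial_sum_le h y b n bn; lia.
Qed.

(** [P] is the invariant kept by the list of sums and [R] the demand on the next term. Both hold for
    [p]-almost all candidates, so a positive one satisfies them. *)
Lemma based_sums_choice (p : set_system nat) (h : nat) (P : seq nat -> Prop)
    (R : seq nat -> nat -> Prop) :
  ProperFilter p -> p [set n | 0 < n] -> P [:: h] ->
  (forall D, P D -> p [set y | P (translate_union D y) /\ R D y]) ->
  exists2 y : nat -> nat, forall n, 0 < y n &
    forall n, P (based_sums h y n) /\ R (based_sums h y n) (y n).
Proof.
move=> pF p0 Ph step.
have /choice[f fP] : forall D, exists y, P D ->
    [/\ 0 < y, P (translate_union D y) & R D y].
  move=> D; have [PD|nPD] := pselect (P D); last by exists 0.
  by have [y [y0 [Py Ry]]] := filter_ex (filterI p0 (step D PD)); exists y.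
pose E n := iter n (fun D => translate_union D (f D)) [:: h].
have EP n : P (E n) by elim: n => //= n /fP[].
have sumsE n : based_sums h (f \o E) n = E n by elim: n => //= n ->.
exists (f \o E) => n; first by have [] := fP _ (EP n).
by rewrite sumsE; have [] := fP _ (EP n).
Qed.

(** * The three patterns along generic sequences *)

Section canonical.
Context (p : set_system nat) (pU : UltraFilter p) (c : nat -> nat).
Hypothesis p_gt0 : p [set n | 0 < n].
Hypothesis p_idem : uprod addn p p = p.

(** The only form in which idempotence is applied to a fixed base [u]: a property of generic [u + n]
    is inherited by the new base [u + m]. *)
Lemma idem_split (u : nat) (A : set nat) :
  p [set n | A (u + n)] -> p [set m | p [set n | A (u + m + n)]].
Proof.
rewrite -{1}p_idem; apply: (@filterS _ p) => m; apply: (@filterS _ p) => n /=.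
by rewrite addnA.
Qed.

Lemma constant_based_sums h : p [set b | c (h + b) = c h] ->
  exists2 y : nat -> nat, forall n, 0 < y n &
    forall n u, u \in based_sums h y n -> c u = c h.
Proof.
move=> hc.
(* The second half of the invariant lets the first half survive the next extension. *)
pose P (D : seq nat) := forall u, u \in D -> c u = c h
  /\ p [set n | c (u + n) = c h].
have [||y y0 yP] := @based_sums_choice p h P (fun _ _ => True) _ p_gt0.
- by move=> u; rewrite inE => /eqP ->.
- move=> D PD.
  have H1 : p [set m | forall u, u \in D -> c (u + m) = c h].
    by apply: filter_seq => u /PD[].
  have H2 : p [set m | forall u, u \in D -> p [set n | c (u + m + n) = c h]].
    by apply: filter_seq => u /PD[_];
      exact: (@idem_split u [set n | c n = c h]).
  apply: filterS (filterI H1 H2) => m [m1 m2]; split=> // v.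
  by move=> /mem_translate_union[/PD//|[u uD ->]]; split; [exact: m1|exact: m2].
by exists y => // n u; have [/(_ u) Pn _] := yP n => /Pn[].
Qed.

(** If generic [u + n] had color [q], then by idempotence so would [u + b + d], making it agree with
    [u + b]. *)
Lemma fresh_color u q :
  p [set b | p [set d | c (u + b) <> c (u + b + d)]] ->
  p [set n | c (u + n) <> q].
Proof.
move=> ub; apply: (ultra_notin pU) => uq.
have uqq := @idem_split u [set n | c n = q] uq.
have [b [[ubd cb] bq]] := filter_ex (filterI (filterI ub uq) uqq).
have [d [bd dq]] := filter_ex (filterI ubd bq).
by apply: bd; rewrite cb dq.
Qed.

Lemma max_colored_based_sums h :
  p [set b | p [set d | c (h + b) <> c (h + b + d)]] ->
  p [set b | p [set n | c (h + b + n) = c (h + n)]] ->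
  exists2 y : nat -> nat, forall n, 0 < y n &
    forall n u, u \in based_sums h y n ->
      c (u + y n) = c (h + y n) /\
      forall v, v \in based_sums h y n -> c (u + y n) <> c v.
Proof.
move=> hfresh hmid.
pose P (D : seq nat) := forall u, u \in D -> p [set n | c (u + n) = c (h + n)].
pose R (D : seq nat) m := forall u, u \in D -> c (u + m) = c (h + m) /\
  forall v, v \in D -> c (u + m) <> c v.
have [||y y0 yP] := @based_sums_choice p h P R _ p_gt0; last first.
- by exists y => // n; have [_] := yP n.
- move=> D PD.
  have H1 : p [set m | forall u, u \in D -> c (u + m) = c (h + m)].
    exact: filter_seq.
  have H2 : p [set m | forall v, v \in D -> c (h + m) <> c v].
    by apply: filter_seq => v _; exact: fresh_color.
  (* Idempotence turns the invariant at [u] into [c (u + m + n) = c (h + m + n)], and [hmid] removes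
     [m] from the right-hand side. *)
  have H3 : p [set m | forall u, u \in D ->
    p [set n | c (u + m + n) = c (h + n)]].
    apply: filter_seq => u /PD; rewrite -{1}p_idem => uc.
    apply: (@filterS _ p _ _ _ _ (@filterI _ p _ _ _ uc hmid)) => m [m1 m2].
    apply: (@filterS _ p _ _ _ _ (@filterI _ p _ _ _ m1 m2)) => n /= [].
    by rewrite !addnA => -> ->.
  apply: filterS (filterI (filterI H1 H2) H3) => m [[m1 m2] m3]; split.
    by move=> v /mem_translate_union[/PD//|[u uD ->]]; exact: m3.
  by move=> u uD; split=> [|v vD]; rewrite m1 //; exact: m2.
- by move=> u; rewrite inE => /eqP ->; apply: filterS filterT.
Qed.

(** What the failure of the first two cases provides at a generic point. *)
Definition splitting (a : nat) : Prop :=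
  p [set b | c a <> c (a + b)] /\
  p [set b | p [set n | c (a + b + n) <> c (a + n)]].

Lemma middle_color u v : p [set b | splitting (u + b)] ->
  p [set b | p [set n | c (u + b + n) <> c (v + n)]].
Proof.
move=> us; suff : ~ p [set b | p [set n | c (u + b + n) = c (v + n)]].
  by move=> /(ultra_notin pU); apply: (@filterS _ p) => b /(ultra_notin pU).
move=> uv.
have uvv := @idem_split u [set b | p [set n | c (b + n) = c (v + n)]] uv.
have [b [[[_ bs] bv] bbv]] := filter_ex (filterI (filterI us uv) uvv).
have [d [ds dv]] := filter_ex (filterI bs bbv).
have [n [[/= n1 n2] n3]] := filter_ex (filterI (filterI ds dv) bv).
by apply: n1; rewrite n2 n3.
Qed.

Lemma rainbow_based_sums h : splitting h -> p [set b | splitting (h + b)] ->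
  exists2 y : nat -> nat, forall n, 0 < y n &
    forall n u v, u \in based_sums h y n -> v \in based_sums h y n ->
      u <> v -> c u <> c v.
Proof.
move=> hs hss.
pose P (D : seq nat) :=
  (forall u, u \in D -> splitting u /\ p [set b | splitting (u + b)]) /\
  forall u v, u \in D -> v \in D -> u <> v ->
    c u <> c v /\ p [set n | c (u + n) <> c (v + n)].
have [||y y0 yP] := @based_sums_choice p h P (fun _ _ => True) _ p_gt0;
  last first.
- by exists y => // n u v uD vD uv; have [[_ /(_ u v uD vD uv)[]]] := yP n.
- move=> D [DS DD].
  have H1 : p [set m | forall u, u \in D ->
      splitting (u + m) /\ p [set b | splitting (u + m + b)]].
    apply: filter_seq => u /DS[_ us].
    by apply: filterI => //; exact: (@idem_split u splitting).
  (* An old sum against a new one, possibly with [u = v]: [fresh_color] separates them now,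
     [middle_color] after a further generic summand. *)
  have H2 : p [set m | forall u, u \in D -> forall v, v \in D ->
      c (u + m) <> c v /\ p [set n | c (u + m + n) <> c (v + n)]].
    apply: filter_seq => u /DS[_ us]; apply: filter_seq => v _.
    apply: filterI; last exact: middle_color.
    by apply: fresh_color; apply: filterS us => b [].
  (* Two new sums: the invariant for [u] and [v], carried past [m] by idempotence. *)
  have H3 : p [set m | forall u, u \in D -> forall v, v \in D -> u <> v ->
      c (u + m) <> c (v + m) /\ p [set n | c (u + m + n) <> c (v + m + n)]].
    apply: filter_seq => u uD; apply: filter_seq => v vD.
    have [->|uv] := pselect (u = v); first by apply: filterS filterT.
    have [_ puv] := DD _ _ uD vD uv; have := puv; rewrite -{1}p_idem => puv2.
    apply: filterS (filterI puv puv2) => m [m1 m2] _; split=> //.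
    by apply: (@filterS _ p) m2 => n /=; rewrite !addnA.
  apply: filterS (filterI (filterI H1 H2) H3) => m [[m1 m2] m3]; split=> //;
    split.
    by move=> v /mem_translate_union[/DS//|[u uD ->]]; exact: m1.
  move=> u v /mem_translate_union[uD|[u' uD ->]]
    /mem_translate_union[vD|[v' vD ->]].
  + exact: DD.
  + move=> _; have [cvu pvu] := m2 _ vD _ uD; split; first exact: nesym.
    by apply: filterS pvu => n; exact: nesym.
  + by move=> _; exact: m2.
  + by move=> uv; apply: m3 => // u'v'; apply: uv; rewrite u'v'.
- split=> [u|u v]; first by rewrite inE => /eqP ->.
  by rewrite !inE => /eqP -> /eqP ->.
Qed.

End canonical.

(** * One of the three patterns always occurs *)

Lemma canonical_altset (k : nat) (c : nat -> nat) : 3 <= k -> odd k ->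
  exists x : nat -> nat, infinite_posset x /\
    (monochromatic c (altset k x) \/ rainbow c (altset k x) \/
     max_colored k c x).
Proof.
move=> k3 ko.
have [||p [pU p0 pp]] := @idempotent_ultrafilter nat addn [set n | 0 < n] addnA.
- by exists 1.
- by move=> a b /= a0 b0; rewrite addn_gt0 a0.
have inD h y n : altset k (partial_sum h y) n ->
  exists m, n \in based_sums h y m.
  move=> [J Jk ->]; have [m [u [_ um ->]]] := altsum_based_sums h y k3 ko Jk.
  by exists m.+1; rewrite mem_cat; apply/orP; right; apply/mapP; exists u.
have inD2 h y a b : altset k (partial_sum h y) a ->
  altset k (partial_sum h y) b ->
    exists m, a \in based_sums h y m /\ b \in based_sums h y m.
  move=> /inD[m am] /inD[n bn]; exists (maxn m n).
  by split; [apply: based_sums_le am|apply: based_sums_le bn];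
    rewrite ?leq_maxl ?leq_maxr.
have [A1|/(ultra_notin pU) nA1] :=
    pselect (p [set a | p [set b | c (a + b) = c a]]).
  have [h [h0 hc]] := filter_ex (filterI p0 A1).
  have [y y0 yP] := constant_based_sums pU p0 pp hc.
  exists (partial_sum h y); split; first exact: infinite_partial_sum.
  by left=> a b /inD[m /yP ->] /inD[n /yP ->].
have {}nA1 : p [set a | p [set b | c a <> c (a + b)]].
  by apply: filterS nA1 => a /(ultra_notin pU); apply: filterS => b;
    exact: nesym.
have fresh : p [set h | p [set b | p [set d | c (h + b) <> c (h + b + d)]]].
  exact: (@idem_split p pU pp 0 [set a | p [set b | c a <> c (a + b)]] nA1).
have [B1|/(ultra_notin pU) nB1] :=
    pselect (p [set a | p [set b | p [set n | c (a + b + n) = c (a + n)]]]).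
  have [h [[h0 hf] hm]] := filter_ex (filterI (filterI p0 fresh) B1).
  have [y y0 yP] := max_colored_based_sums pU p0 pp hf hm.
  exists (partial_sum h y); split; first exact: infinite_partial_sum.
  right; right=> I J Ik Jk.
  have [m [u [-> um ->]]] := altsum_based_sums h y k3 ko Ik.
  have [n [v [-> vn ->]]] := altsum_based_sums h y k3 ko Jk.
  (* A sum with smaller maximal index is already in the list when [y n'] is chosen, so its color is
     avoided. *)
  have lt_neq m' n' u' v' : m' < n' -> u' \in based_sums h y m' ->
      v' \in based_sums h y n' -> c (v' + y n') <> c (u' + y m').
    move=> mn um' vn'; have [_] := yP _ _ vn'; apply.
    apply: (based_sums_le mn); rewrite mem_cat; apply/orP; right; apply/mapP.
    by exists u'.
  split=> [cuv|[mn]].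
    case: (ltngtP m n) => [mn|nm|->//].
    - by have := lt_neq _ _ _ _ mn um vn; rewrite cuv.
    - by have := lt_neq _ _ _ _ nm vn um; rewrite cuv.
  by move: vn; rewrite -mn => /yP[-> _]; have [-> _] := yP _ _ um.
have sp : p [set a | splitting p c a].
  apply: filterI => //; apply: filterS nB1 => a /(ultra_notin pU).
  by apply: filterS => b /(ultra_notin pU).
have sps := @idem_split p pU pp 0 (splitting p c) sp.
have [h [[h0 hs] hss]] := filter_ex (filterI (filterI p0 sp) sps).
have [y y0 yP] := rainbow_based_sums pU p0 pp hs hss.
exists (partial_sum h y); split; first exact: infinite_partial_sum.
by right; left=> a b aX bX; have [n [an bn]] := inD2 _ _ _ _ aX bX;
  exact: yP an bn.
Qed.

(** * Colorings that exclude two of the patterns *)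

Lemma sort_seq_fset (s : seq nat) :
  sorted gtn s -> sort geq (seq_fset tt s) = s.
Proof.
rewrite gtn_sorted_uniq_geq => /andP[us ss].
apply: (@sorted_eq _ geq).
- by move=> i j l /= ij jl; exact: leq_trans jl ij.
- by move=> i j; rewrite /= andbC -eqn_leq => /eqP.
- by apply: sort_sorted => i j; exact: leq_total.
- by [].
- by rewrite perm_sort (perm_trans (seq_fset_perm _ _)) // undup_id.
Qed.

(** Test sums: the [k] smallest indices are fixed, so comparing two sums reduces to comparing
    [x n - x j]. *)
Lemma altsum_two_largest (k j n : nat) : k <= j -> j < n ->
  exists J : {fset nat}, [/\ #|` J| = k.+2, fsmax J = n &
    forall x, altsum x J = x n - x j + altseq [seq x i | i <- rev (iota 0 k)]].
Proof.
move=> kj jn; pose s := [:: n, j & rev (iota 0 k)].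
have ss : sorted gtn s.
  rewrite /s /= jn path_sortedE; last by move=> a b l /= ab bl;
    exact: ltn_trans bl ab.
  rewrite rev_sorted iota_ltn_sorted andbT; apply/allP => i.
  by rewrite mem_rev mem_iota => /leq_trans; apply.
exists (seq_fset tt s); split.
- by rewrite -(size_sort geq) sort_seq_fset //= size_rev size_iota.
- by rewrite fsmax_head sort_seq_fset.
- by move=> x; rewrite /altsum sort_seq_fset.
Qed.

Lemma infinite_posset_geq (x : nat -> nat) (n : nat) :
  infinite_posset x -> n <= x n.
Proof.
move=> [_ x_inc]; elim: n => // n IHn; exact: leq_ltn_trans IHn (x_inc _ _ _).
Qed.

Lemma constant_coloring_excludes (k : nat) (x : nat -> nat) :
  infinite_posset x ->
  ~ rainbow (fun=> 1) (altset k.+2 x) /\ ~ max_colored k.+2 (fun=> 1) x.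
Proof.
move=> [x0 x_inc].
have [I [Ik Imax IE]] := @altsum_two_largest k k k.+1 (leqnn _) (ltnSn _).
have [J [Jk Jmax JE]] := @altsum_two_largest k k k.+2 (leqnn _) (leqnSn k.+1).
split=> [rb|mc].
  apply: (rb (altsum x I) (altsum x J)) => //; [by exists I|by exists J|].
  have := x_inc k k.+1 (ltnSn _); have := x_inc k.+1 k.+2 (ltnSn _).
  by rewrite IE JE; lia.
by have [/(_ erefl)] := mc I J Ik Jk; rewrite Imax Jmax; lia.
Qed.

(** Two distinct sums with the same maximal index contradict both patterns. *)
Lemma injective_coloring_excludes (k : nat) (c x : nat -> nat) :
  injective c -> infinite_posset x ->
  ~ monochromatic c (altset k.+2 x) /\ ~ max_colored k.+2 c x.
Proof.
move=> c_inj [x0 x_inc].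
have [I [Ik Imax IE]] := @altsum_two_largest k k k.+2 (leqnn _) (leqnSn k.+1).
have [J [Jk Jmax JE]] := @altsum_two_largest k k.+1 k.+2 (leqnSn _) (ltnSn _).
have IJ : altsum x I <> altsum x J.
  have := x_inc k k.+1 (ltnSn _); have := x_inc k.+1 k.+2 (ltnSn _).
  by rewrite IE JE; lia.
split=> [mono|mc]; apply: IJ; apply: c_inj.
  by apply: mono; [exists I|exists J].
by apply/(mc I J Ik Jk); rewrite Imax Jmax.
Qed.

(* Sums differing by a bounded amount around a large value fall into at most
   two dyadic intervals, so among three of them two share their color. *)
Lemma log_coloring_excludes (k : nat) (x : nat -> nat) :
  infinite_posset x ->
  ~ monochromatic (fun n => (trunc_log 2 n).+1) (altset k.+2 x) /\
  ~ rainbow (fun n => (trunc_log 2 n).+1) (altset k.+2 x).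
Proof.
move=> xP; have [x0 x_inc] := xP.
have x1 := x_inc k k.+1 (ltnSn _); have x2 := x_inc k.+1 k.+2 (ltnSn _).
split.
  have [I [Ik _ /(_ x) IE]] := @altsum_two_largest k k k.+1 (leqnn _) (ltnSn _).
  (* Since [n <= x n], this makes the second sum at least twice the first, which raises the
     logarithm. *)
  pose n := k.+1 + x k + 2 * altsum x I.
  have kn : k < n by rewrite /n; lia.
  have [J [Jk _ /(_ x) JE]] := @altsum_two_largest k k n (leqnn _) kn.
  have I0 : 0 < altsum x I by rewrite IE; lia.
  have IJ : 2 * altsum x I <= altsum x J.
    by have := infinite_posset_geq n xP; rewrite JE /n; lia.
  move=> mono; have [] :
      (trunc_log 2 (altsum x I)).+1 = (trunc_log 2 (altsum x J)).+1.
    by apply: mono; [exists I|exists J].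
  have := leq_trunc_log 2 IJ; rewrite mul2n trunc_log2_double //; lia.
(* [x n] is then so large compared with [x k.+2] that the three sums below lie within a factor of
   2. *)
pose n := k.+3 + 3 * x k.+2.
have xn := infinite_posset_geq n xP.
have [I [Ik _ /(_ x) IE]] := @altsum_two_largest k k.+2 n (leqW (leqnSn _))
  ltac:(rewrite /n; lia).
have [J [Jk _ /(_ x) JE]] := @altsum_two_largest k k.+1 n (leqnSn _)
  ltac:(rewrite /n; lia).
have [H [Hk _ /(_ x) HE]] := @altsum_two_largest k k n (leqnn _)
  ltac:(rewrite /n; lia).
have IJ : altsum x I < altsum x J by rewrite IE JE /n in xn *; lia.
have JH : altsum x J < altsum x H by rewrite JE HE /n in xn *; lia.
have HI : altsum x H < 2 * altsum x I by rewrite IE HE /n in xn *; lia.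
have aI : altset k.+2 x (altsum x I) by exists I.
have aJ : altset k.+2 x (altsum x J) by exists J.
have aH : altset k.+2 x (altsum x H) by exists H.
move=> rb.
have cIJ := rb _ _ aI aJ ltac:(lia); have cJH := rb _ _ aJ aH ltac:(lia).
have lIJ := leq_trunc_log 2 (ltnW IJ); have lJH := leq_trunc_log 2 (ltnW JH).
have := leq_trunc_log 2 (ltnW HI); rewrite mul2n trunc_log2_double; lia.
Qed.

Theorem theorem8p1 (k : nat) (hk3 : 3 <= k) (hkodd : odd k) :
  (forall Delta : nat -> nat, coloring Delta ->
     exists x : nat -> nat, infinite_posset x /\
       (monochromatic Delta (altset k x) \/
        rainbow Delta (altset k x) \/
        max_colored k Delta x)) /\
  (exists Delta : nat -> nat, coloring Delta /\
     forall x : nat -> nat, infinite_posset x ->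
       ~ rainbow Delta (altset k x) /\ ~ max_colored k Delta x) /\
  (exists Delta : nat -> nat, coloring Delta /\
     forall x : nat -> nat, infinite_posset x ->
       ~ monochromatic Delta (altset k x) /\ ~ max_colored k Delta x) /\
  (exists Delta : nat -> nat, coloring Delta /\
     forall x : nat -> nat, infinite_posset x ->
       ~ monochromatic Delta (altset k x) /\ ~ rainbow Delta (altset k x)).
Proof.
split; first by move=> Delta _; exact: canonical_altset.
case: k hk3 hkodd => [|[|k]] // _ _; split; last split.
- by exists (fun=> 1); split=> // x; exact: constant_coloring_excludes.
- by exists succn; split=> // x; apply: injective_coloring_excludes => m n [].
- exists (fun n => (trunc_log 2 n).+1); split=> // x.
  exact: log_coloring_excludes.
Qed.
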